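(* For every integer $n\ge 1$, we have $2\cdot d_{\mathrm{GH}}(S^n,S^{n+1})\le \frac{2\pi}{3}$.
   Context: $S^n=\{x\in\mathbb{R}^{n+1}\mid \|x\|=1\}$ carries the geodesic metric $d_{S^n}(x,x')=\arccos\langle x,x'\rangle$. The Gromov--Hausdorff distance $d_{\mathrm{GH}}(X,Y)$ of bounded metric spaces is the infimum, over all metric spaces $Z$ and isometric embeddings $\gamma\colon X\to Z$, $\varphi\colon Y\to Z$, of the Hausdorff distance in $Z$ between $\gamma(X)$ and $\varphi(Y)$. Equivalently, $2\,d_{\mathrm{GH}}(X,Y)=\inf_R \sup_{(x,y),(x',y')\in R}|d_X(x,x')-d_Y(y,y')|$, where $R\subseteq X\times Y$ ranges over all relations whose projections to $X$ and to $Y$ are surjective. *)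

(* Defs.v *)
From HB Require Import structures.
From mathcomp Require Import all_boot all_order all_algebra.
From mathcomp Require Import all_classical all_reals all_analysis.
From mathcomp Require Import ring lra.

Set Implicit Arguments.
Unset Strict Implicit.
Unset Printing Implicit Defensive.

Import Order.TTheory GRing.Theory Num.Theory.

Local Open Scope classical_set_scope.
Local Open Scope ring_scope.

(* The library's norm on ['rV[R]_n] is the sup norm, so the Euclidean inner
   product and norm are introduced here. *)
Section euclidean.
Context {R : realType} {n : nat}.
Implicit Types (u v w : 'rV[R]_n) (a b : R).

Definition dotv u v : R := \sum_(i < n) u ord0 i * v ord0 i.

Definition enorm u : R := Num.sqrt (dotv u u).

Lemma dotvC u v : dotv u v = dotv v u.
Proof. by apply: eq_bigr => i _; rewrite mulrC. Qed.

Lemma dotv_linl a b u v w :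
  dotv (a *: u + b *: v) w = a * dotv u w + b * dotv v w.
Proof.
rewrite /dotv !mulr_sumr -big_split /=; apply: eq_bigr => i _.
by rewrite !mxE mulrDl !mulrA.
Qed.

Lemma dotv_linr a b u v w :
  dotv w (a *: u + b *: v) = a * dotv w u + b * dotv w v.
Proof. by rewrite dotvC dotv_linl !(dotvC w). Qed.

Lemma dotv_ge0 u : 0 <= dotv u u.
Proof. by apply: sumr_ge0 => i _; rewrite -expr2 sqr_ge0. Qed.

Lemma dotv_eq0 u : dotv u u = 0 -> u = 0.
Proof.
move=> /eqP; rewrite psumr_eq0; last by move=> i _; rewrite -expr2 sqr_ge0.
move=> /allP u0; apply/rowP => i; rewrite mxE.
by have := u0 i (mem_index_enum i); rewrite mulf_eq0 orbb => /eqP.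
Qed.

Lemma dotv_CS u v : dotv u v ^+ 2 <= dotv u u * dotv v v.
Proof.
have [v0|vN0] := eqVneq (dotv v v) 0.
  have -> : dotv u v = 0.
    by rewrite (dotv_eq0 v0) /dotv big1 // => i _; rewrite mxE mulr0.
  by rewrite v0 mulr0 expr0n.
have vgt0 : 0 < dotv v v by rewrite lt_neqAle eq_sym vN0 dotv_ge0.
have := dotv_ge0 (dotv v v *: u + (- dotv u v) *: v).
rewrite dotv_linl !dotv_linr (dotvC v u) => h.
rewrite -subr_ge0 -(pmulr_rge0 _ vgt0); lra.
Qed.

End euclidean.

(* The unit sphere [S^n] of [R^(n+1)]. *)
Record sphere (R : realType) (n : nat) := Sphere {
  sphere_val :> 'rV[R]_n.+1 ;
  sphereP : enorm sphere_val == 1 }.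

HB.instance Definition _ (R : realType) (n : nat) :=
  [isSub for @sphere_val R n].
HB.instance Definition _ (R : realType) (n : nat) :=
  [Choice of sphere R n by <:].

Section geodesic_distance.
Context {R : realType} {n : nat}.
Implicit Types x y z : sphere R n.

Definition geodist x y : R := acos (dotv x y).

Lemma sphere_dotv x : dotv x x = 1.
Proof.
by rewrite -(sqr_sqrtr (dotv_ge0 x)) -/(enorm x) (eqP (sphereP x)) expr1n.
Qed.

Lemma sphere_dotv_itv x y : -1 <= dotv x y <= 1.
Proof.
by have := dotv_CS x y; rewrite !sphere_dotv => h; apply/andP; split; nra.
Qed.

Let in11 x y : dotv x y \in `[(-1), 1].
Proof. by rewrite in_itv /= sphere_dotv_itv. Qed.

Lemma geodistxx x : geodist x x = 0.
Proof. by rewrite /geodist sphere_dotv acos1. Qed.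

Lemma geodist_positivity x y : geodist x y = 0 -> x = y.
Proof.
move=> /(congr1 cos); rewrite acosK// cos0 => xy; apply: val_inj => /=.
apply/eqP; rewrite -subr_eq0; apply/eqP/dotv_eq0.
rewrite -[X in X - _]scale1r -scaleN1r dotv_linl !dotv_linr (dotvC y x).
rewrite !sphere_dotv xy; ring.
Qed.

Lemma geodist_sym x y : geodist x y = geodist y x.
Proof. by rewrite /geodist dotvC. Qed.

Lemma geodist_triangle y x z : geodist x z <= geodist x y + geodist y z.
Proof.
have ge0 u v : 0 <= geodist u v by exact/acos_ge0/sphere_dotv_itv.
have lepi u v : geodist u v <= pi by exact/acos_lepi/sphere_dotv_itv.
have [hpi|hpi] := leP pi (geodist x y + geodist y z).
  exact: le_trans (lepi _ _) hpi.
rewrite leNgt; apply/negP => hlt.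
have := hlt; rewrite -ltr_cos ?in_itv/= ?addr_ge0 ?ge0 ?lepi ?(ltW hpi)//.
apply/negP; rewrite -leNgt cosD !acosK//.
set s1 := sin _; set s2 := sin _.
have s1E : s1 ^+ 2 = 1 - dotv x y ^+ 2 by rewrite sin2cos2 acosK.
have s2E : s2 ^+ 2 = 1 - dotv y z ^+ 2 by rewrite sin2cos2 acosK.
have s1_ge0 : 0 <= s1 by rewrite sin_ge0_pi ?ge0 ?lepi.
have s2_ge0 : 0 <= s2 by rewrite sin_ge0_pi ?ge0 ?lepi.
have := dotv_CS (1 *: (x : 'rV__) + (- dotv x y) *: (y : 'rV__))
                (1 *: (z : 'rV__) + (- dotv y z) *: (y : 'rV__)).
rewrite !dotv_linl !dotv_linr !sphere_dotv (dotvC y x) (dotvC z y).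
set p := dotv x y in s1E *; set q := dotv y z in s2E *; set r := dotv x z.
move=> h; have {}h : (p * q - r) ^+ 2 <= (s1 * s2) ^+ 2.
  rewrite exprMn s1E s2E; lra.
suff : p * q - r <= s1 * s2 by lra.
have s12 : 0 <= s1 * s2 by rewrite mulr_ge0.
by rewrite leNgt; apply/negP => hc; nra.
Qed.

End geodesic_distance.

HB.instance Definition _ (R : realType) (n : nat) :=
  isMetric.Build R (sphere R n) (@geodistxx R n) (@geodist_positivity R n)
    (@geodist_sym R n) (@geodist_triangle R n).

Lemma mdist_sphereE (R : realType) (n : nat) (x y : sphere R n) :
  mdist x y = acos (dotv x y).
Proof. by []. Qed.

Section gromov_hausdorff.
Context {R : realType}.

Definition isometric_embedding (X Z : metricType R) (f : X -> Z) : Prop :=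
  forall x x', mdist (f x) (f x') = mdist x x'.

Definition hausdorff_distance (Z : metricType R) (A B : set Z) : \bar R :=
  ereal_inf [set r%:E | r in
    [set r : R | 0 < r /\ A `<=` \bigcup_(b in B) ball b r
                       /\ B `<=` \bigcup_(a in A) ball a r]].

Definition gromov_hausdorff (X Y : metricType R) : \bar R :=
  ereal_inf [set d | exists (Z : metricType R) (f : X -> Z) (g : Y -> Z),
    [/\ isometric_embedding f, isometric_embedding g
      & d = hausdorff_distance (range f) (range g)]].

End gromov_hausdorff.

(* Main.v *)
From HB Require Import structures.
Require Import Defs.
From mathcomp Require Import all_boot all_order all_algebra.
From mathcomp Require Import all_classical all_reals all_analysis.
From mathcomp Require Import ring lra.

Set Implicit Arguments.
Unset Strict Implicit.
Unset Printing Implicit Defensive.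

Import Order.TTheory GRing.Theory Num.Theory.

(** View S^n as the equator of S^(n+1), with poles N and -N. By the description
of the Gromov-Hausdorff distance through correspondences
([gromov_hausdorff_le_correspondence]), it suffices to relate points of S^n to
points of S^(n+1), each point of either sphere being related to some point of
the other, in such a way that distances between related pairs change by at
most 2 pi/3.

Near the equator, at latitude at most pi/6 in absolute value, y is related to
its normalised projection to the equator, or more generally to any point of
the equator within pi/6 of y. Points close to a pole cannot be treated in this
way, since arbitrarily close ones may have antipodal projections. Instead, the
cap of radius pi/3 around N is collapsed onto a set P of points of S^n of
diameter at most 2 pi/3, each y being related to the points of P within pi/2
of y, and the cap around -N is collapsed antipodally. With n >= 1, the vertices
of an equilateral triangle inscribed in a great circle of S^n can serve as P
([equilateral_triangle]): they sum to 0, so they cannot all have a negative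
inner product with a given vector.

The bound on the distortion ([sphere_corr_distortion]) then needs nothing but
the triangle inequality. If one of two related pairs lies near the equator,
the total displacement is at most pi/6 + pi/2 = 2 pi/3. If both lie in the same
cap, all distances involved are in [0, 2 pi/3], because the cap and P
have diameter at most 2 pi/3. If they lie in opposite caps, replacing one pair by its
antipode changes each distance d into pi - d and reduces to the previous
case. *)

Local Open Scope classical_set_scope.
Local Open Scope ring_scope.

(** * Correspondences bound the Gromov-Hausdorff distance *)

Section glued_metric.
Context {R : realType} {X Y : metricType R}.
Variables (C : X -> Y -> Prop) (c : R).
Hypothesis c_gt0 : 0 < c.
Hypothesis C_total : forall x, exists y, C x y.
Hypothesis C_surjective : forall y, exists x, C x y.
Hypothesis C_distortion : forall x y x' y', C x y -> C x' y' ->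
  `|mdist x x' - mdist y y'| <= 2 * c.

(** The lengths of the paths from [x] to [y] that cross once from [X] to [Y],
where each pair related by [C] is joined by a bridge of length [c]. *)
Definition cross_lengths (x : X) (y : Y) : set R :=
  [set mdist x p.1 + c + mdist p.2 y | p in [set p | C p.1 p.2]].

Definition cross_dist (x : X) (y : Y) : R := inf (cross_lengths x y).

Let lb_cross x y : lbound (cross_lengths x y) c.
Proof.
move=> _ [[a b] _ <-] /=.
have := mdist_ge0 x a; have := mdist_ge0 b y; lra.
Qed.

Let has_inf_cross x y : has_inf (cross_lengths x y).
Proof.
split; last by exists c; exact: lb_cross.
by have [b ab] := C_total x; exists (mdist x x + c + mdist b y); exists (x, b).
Qed.

Let cross_dist_le x y a b :
  C a b -> cross_dist x y <= mdist x a + c + mdist b y.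
Proof.
move=> ab; apply: ge_inf; first by have [] := has_inf_cross x y.
by exists (a, b).
Qed.

(** The infimum need not be attained, so the inequalities below are obtained
from almost optimal bridges, up to an arbitrary [e]. *)
Let cross_dist_approx x y e : 0 < e ->
  exists a b, C a b /\ mdist x a + c + mdist b y < cross_dist x y + e.
Proof.
move=> e0; have [_ [[a b] ab <-] lt_e] := inf_adherent e0 (has_inf_cross x y).
by exists a, b.
Qed.

Let cross_dist_ge x y : c <= cross_dist x y.
Proof. by apply: lb_le_inf (@lb_cross x y); have [] := has_inf_cross x y. Qed.

Let cross_distl x x' y : cross_dist x y <= mdist x x' + cross_dist x' y.
Proof.
apply/ler_addgt0Pr => e e0; have [a [b [ab h]]] := cross_dist_approx x' y e0.
have := cross_dist_le x y ab; have := metric_triangle x x' a; lra.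
Qed.

Let cross_distr x y y' : cross_dist x y <= cross_dist x y' + mdist y' y.
Proof.
apply/ler_addgt0Pr => e e0; have [a [b [ab h]]] := cross_dist_approx x y' e0.
have := cross_dist_le x y ab; have := metric_triangle b y' y; lra.
Qed.

(** Crossing to [Y] and back is no shortcut within [X]: the two bridges cost
[2 * c], which pays for the distortion of [C]. *)
Let mdist_le_crossl x x' y : mdist x x' <= cross_dist x y + cross_dist x' y.
Proof.
apply/ler_addgt0Pr => e e0; have e2 : 0 < e / 2 by lra.
have [a [b [ab h]]] := cross_dist_approx x y e2.
have [a' [b' [ab' h']]] := cross_dist_approx x' y e2.
have := C_distortion ab ab'; rewrite ler_norml => /andP[_].
have := metric_triangle x a x'; have := metric_triangle a a' x'.
rewrite (metric_sym a' x').
have := metric_triangle b y b'; rewrite (metric_sym y b'); lra.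
Qed.

Let mdist_le_crossr x y y' : mdist y y' <= cross_dist x y + cross_dist x y'.
Proof.
apply/ler_addgt0Pr => e e0; have e2 : 0 < e / 2 by lra.
have [a [b [ab h]]] := cross_dist_approx x y e2.
have [a' [b' [ab' h']]] := cross_dist_approx x y' e2.
have := C_distortion ab ab'; rewrite ler_norml => /andP[+ _].
have := metric_triangle y b y'; have := metric_triangle b b' y'.
rewrite (metric_sym y b).
have := metric_triangle a x a'; rewrite (metric_sym a x); lra.
Qed.

Definition glued_dist (p q : X + Y) : R :=
  match p, q with
  | inl x, inl x' => mdist x x'
  | inr y, inr y' => mdist y y'
  | inl x, inr y | inr y, inl x => cross_dist x y
  end.

Let glued_distxx p : glued_dist p p = 0.
Proof. by case: p => z; exact: mdistxx. Qed.

Let glued_dist_positivity p q : glued_dist p q = 0 -> p = q.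
Proof.
have cross_neq0 x y : cross_dist x y <> 0.
  by have := cross_dist_ge x y => /[swap] ->; rewrite leNgt c_gt0.
by case: p q => [x|y] [x'|y'] //= => [/mdist_positivity->|/cross_neq0|
  /cross_neq0|/mdist_positivity->].
Qed.

Let glued_dist_sym p q : glued_dist p q = glued_dist q p.
Proof. by case: p q => [x|y] [x'|y'] //=; exact: metric_sym. Qed.

Let glued_dist_triangle q p r :
  glued_dist p r <= glued_dist p q + glued_dist q r.
Proof.
case: p q r => [x|y] [x'|y'] [x''|y''] /=; try exact: metric_triangle.
- exact: cross_distl.
- exact: mdist_le_crossl.
- exact: cross_distr.
- by rewrite addrC metric_sym; exact: cross_distl.
- exact: mdist_le_crossr.
- by rewrite addrC metric_sym; exact: cross_distr.
Qed.

(** In the disjoint union glued along the bridges, every point of [X] or [Y] is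
at distance [c] from a related point of the other space. *)
Lemma gromov_hausdorff_le_correspondence :
  (gromov_hausdorff X Y <= c%:E)%E.
Proof.
pose glued_isMetric := isMetric.Build R (X + Y)%type
  glued_distxx glued_dist_positivity glued_dist_sym glued_dist_triangle.
pose Z : metricType R := HB.pack (X + Y)%type glued_isMetric.
pose f (x : X) : Z := inl x; pose g (y : Y) : Z := inr y.
apply: (@le_trans _ _ (hausdorff_distance (range f) (range g))).
  by apply: ereal_inf_lbound; exists Z, f, g; split.
apply/lee_addgt0Pr => e e0; apply: ereal_inf_lbound.
have near x y : C x y -> cross_dist x y < c + e.
  by move=> xy; have := cross_dist_le x y xy; rewrite !mdistxx; lra.
exists (c + e) => //; split; first exact: addr_gt0.
split=> [_ [x _ <-]|_ [y _ <-]].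
- have [y xy] := C_total x; exists (g y); first by exists y.
  by rewrite ballEmdist /=; exact: near.
- have [x xy] := C_surjective y; exists (f x); first by exists x.
  by rewrite ballEmdist /=; exact: near.
Qed.

End glued_metric.

(** * The angles pi/3 and pi/6 *)

Lemma cos_pi3 (R : realType) : cos (pi / 3) = 1 / 2 :> R.
Proof.
have pi0 := pi_gt0 R.
have gt0 : 0 < cos (pi / 3) :> R.
  by apply: cos_gt0_pihalf; apply/andP; split; lra.
(* [2 * pi / 3] is both the double and the supplement of [pi / 3]. *)
have := cos_mulr2n (pi / 3 : R).
have -> : pi / 3 *+ 2 = - (pi / 3) + pi :> R by rewrite mulr2n; field.
rewrite cosDpi cosN mulr2n => h.
have /eqP : (cos (pi / 3) + 1) * (cos (pi / 3) - 1 / 2) = 0 :> R by lra.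
by rewrite mulf_eq0 => /orP[] /eqP; lra.
Qed.

Lemma cos_pi6_sqr (R : realType) : cos (pi / 6) ^+ 2 = 3 / 4 :> R.
Proof.
have := cos_mulr2n (pi / 6 : R).
have -> : pi / 6 *+ 2 = pi / 3 :> R by rewrite mulr2n; field.
rewrite mulr2n cos_pi3; lra.
Qed.

(** * Spheres, antipodes and the equator *)

Section dotv_theory.
Context {R : realType} {n : nat}.
Implicit Types u v : 'rV[R]_n.

Lemma dotvNl u v : dotv (- u) v = - dotv u v.
Proof. by rewrite /dotv -sumrN; apply: eq_bigr => i _; rewrite mxE mulNr. Qed.

Lemma dotv0l u : dotv 0 u = 0.
Proof. by rewrite /dotv big1 // => i _; rewrite mxE mul0r. Qed.

Lemma dotvZl a u v : dotv (a *: u) v = a * dotv u v.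
Proof. by rewrite /dotv mulr_sumr; apply: eq_bigr => i _; rewrite mxE mulrA. Qed.

Lemma dotv_deltar u i : dotv u (delta_mx ord0 i) = u ord0 i.
Proof.
rewrite /dotv (bigD1 i) //= mxE !eqxx mulr1 big1 ?addr0 // => j /negPf ji.
by rewrite mxE ji andbF mulr0.
Qed.

Lemma enorm_eq1 u : dotv u u = 1 -> enorm u == 1.
Proof. by rewrite /enorm => ->; rewrite sqrtr1. Qed.

(** The first coordinate [t] serves as the height above the equator. *)
Definition cylindrical (t : R) v : 'rV[R]_n.+1 := row_mx t%:M v.

Lemma cylindricalP (w : 'rV[R]_n.+1) : exists t v, w = cylindrical t v.
Proof.
exists ((lsubmx (w : 'rV_(1 + n))) ord0 ord0), (rsubmx (w : 'rV_(1 + n))).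
by rewrite /cylindrical -mx11_scalar hsubmxK.
Qed.

Lemma dotv_cylindrical t u s v :
  dotv (cylindrical t u) (cylindrical s v) = t * s + dotv u v.
Proof.
have head r w : cylindrical r w ord0 (lshift n (ord0 : 'I_1)) = r.
  by apply: etrans (row_mxEl _ _ _ _) _; rewrite mxE mulr1n.
have tail r w i : cylindrical r w ord0 (rshift 1 i) = w ord0 i.
  exact: row_mxEr.
rewrite /dotv (@big_split_ord _ _ _ 1 n) /= big_ord1 !head.
by congr (_ + _); apply: eq_bigr => i _; rewrite !tail.
Qed.

End dotv_theory.

Section sphere_theory.
Context {R : realType} {n : nat}.
Implicit Types x y : sphere R n.

Lemma mdist_sphere_le x y a :
  0 <= a <= pi -> (mdist x y <= a) = (cos a <= dotv x y).
Proof.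
move=> a_itv; have xy_itv := sphere_dotv_itv x y.
have xy11 : dotv x y \in `[(-1), 1] by rewrite in_itv.
rewrite mdist_sphereE -{2}(acosK xy11) !leNgt ltr_cos // in_itv /=.
by rewrite acos_ge0 ?acos_lepi.
Qed.

Lemma antipode_subproof x : enorm (- sphere_val x) == 1.
Proof. by apply: enorm_eq1; rewrite dotvNl dotvC dotvNl sphere_dotv opprK. Qed.

Definition antipode x : sphere R n := Sphere (antipode_subproof x).

Lemma antipodeK : involutive antipode.
Proof. by move=> x; apply: val_inj; rewrite /= opprK. Qed.

Lemma mdist_antipodel x y : mdist (antipode x) y = pi - mdist x y.
Proof. by rewrite !mdist_sphereE /= dotvNl acosN // sphere_dotv_itv. Qed.

Lemma mdist_antipoder x y : mdist x (antipode y) = pi - mdist x y.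
Proof. by rewrite metric_sym mdist_antipodel metric_sym. Qed.

End sphere_theory.

Section equator.
Context {R : realType} {n : nat}.
Implicit Types x : sphere R n.

Lemma equator_subproof x : enorm (cylindrical 0 x) == 1.
Proof. by apply: enorm_eq1; rewrite dotv_cylindrical mul0r add0r sphere_dotv. Qed.

Definition equator x : sphere R n.+1 := Sphere (equator_subproof x).

Lemma north_subproof : enorm (cylindrical 1 (0 : 'rV[R]_n.+1)) == 1.
Proof. by apply: enorm_eq1; rewrite dotv_cylindrical dotv0l addr0 mul1r. Qed.

Definition north : sphere R n.+1 := Sphere north_subproof.

Lemma mdist_equator x x' : mdist (equator x) (equator x') = mdist x x'.
Proof. by rewrite !mdist_sphereE /= dotv_cylindrical mul0r add0r. Qed.

(** The equator is isometric to [sphere R n], so moving the two ends of a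
segment by at most [a] and [b] changes its length by at most [a + b]. *)
Lemma distortion_le_displacement x x' (y y' : sphere R n.+1) a b :
  mdist (equator x) y <= a -> mdist (equator x') y' <= b ->
  `|mdist x x' - mdist y y'| <= a + b.
Proof.
rewrite -(mdist_equator x) ler_norml => xy xy'.
have := metric_triangle (equator x) y (equator x').
have := metric_triangle y y' (equator x').
have := metric_triangle y (equator x) y'.
have := metric_triangle (equator x) (equator x') y'.
rewrite (metric_sym y (equator x)) (metric_sym y' (equator x')).
by move=> *; apply/andP; split; lra.
Qed.

End equator.

(** * The correspondence between consecutive spheres *)

Section correspondence.
Context {R : realType} {n : nat}.
Variable P : set (sphere R n).
Hypothesis P_diam : forall p q, P p -> P q -> mdist p q <= 2 * pi / 3.
Hypothesis P_halfspace : forall v : 'rV[R]_n.+1, exists2 p, P p & 0 <= dotv p v.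

(** Taking the antipodes of both points exchanges the last two clauses. Every
clause bounds the displacement by [pi / 2]; in a cap, this bound is what a set
of diameter [2 * pi / 3] can achieve, and together with the [pi / 6] of the
first clause it adds up to [2 * pi / 3]. *)
Inductive sphere_corr (x : sphere R n) (y : sphere R n.+1) : Prop :=
  | corr_band of mdist (equator x) y <= pi / 6
  | corr_north of P x & mdist (equator x) y <= pi / 2 & mdist north y <= pi / 3
  | corr_south of P (antipode x) & mdist (equator x) y <= pi / 2
      & mdist (antipode north) y <= pi / 3.

Lemma sphere_corr_displacement x y :
  sphere_corr x y -> mdist (equator x) y <= pi / 2.
Proof. by case=> // h; have := pi_gt0 R; lra. Qed.

Lemma sphere_corr_total x : exists y, sphere_corr x y.
Proof.
exists (equator x); apply: corr_band; rewrite mdistxx.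
by have := pi_gt0 R; lra.
Qed.

(** A point [y] at height [t] lies in a cap when [1 / 2 <= `|t|], that is when
its latitude is at least [pi / 6] in absolute value. Otherwise its projection
to the equatorial hyperplane has norm [k] with [k ^+ 2 = 1 - t ^+ 2 >= 3 / 4],
and [k] is the cosine of the angle between [y] and the normalised
projection. *)
Lemma sphere_corr_surjective y : exists x, sphere_corr x y.
Proof.
have pi0 := pi_gt0 R.
have [t [v yE]] := cylindricalP y.
have := sphere_dotv y; rewrite {1 2}yE dotv_cylindrical => tv1.
have dotE x : dotv (equator x) y = dotv x v.
  by rewrite yE dotv_cylindrical mul0r add0r.
have dotN : dotv (@north R n) y = t.
  by rewrite yE dotv_cylindrical dotv0l addr0 mul1r.
have [t_ge|t_lt] := leP (1 / 2) t.
  have [p Pp pv] := P_halfspace v.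
  exists p; apply: corr_north => //; rewrite mdist_sphere_le; try lra.
  - by rewrite cos_pihalf dotE.
  - by rewrite cos_pi3 dotN.
have [t_le|t_gt] := leP t (- 1 / 2).
  have [p Pp pv] := P_halfspace (- v).
  exists (antipode p); apply: corr_south; first by rewrite antipodeK.
  - rewrite mdist_sphere_le; last by lra.
    by rewrite cos_pihalf dotE dotvNl dotvC -dotvNl dotvC.
  - rewrite mdist_sphere_le; last by lra.
    by rewrite cos_pi3 dotvNl dotN; lra.
set k := Num.sqrt (dotv v v).
have kk : k ^+ 2 = dotv v v by rewrite sqr_sqrtr // dotv_ge0.
have k_sqr_ge : 3 / 4 <= k ^+ 2 by rewrite kk; nra.
have k_ge0 : 0 <= k by exact: sqrtr_ge0.
have k_neq0 : k != 0 by apply/eqP => k0; move: k_sqr_ge; rewrite k0; lra.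
have x1 : enorm (k^-1 *: v) == 1.
  by apply: enorm_eq1; rewrite dotvZl dotvC dotvZl -kk; field.
exists (Sphere x1); apply: corr_band; rewrite mdist_sphere_le; last by lra.
rewrite dotE /= dotvZl -kk expr2 mulKf //.
have := cos_pi6_sqr R => c6; rewrite leNgt; apply/negP => k_lt; nra.
Qed.

(** Both distances lie between 0 and [2 * pi / 3]: the bound on [mdist y y']
comes from passing through the centre [N] of the cap. *)
Lemma cap_distortion x x' (N y y' : sphere R n.+1) :
  P x -> P x' -> mdist N y <= pi / 3 -> mdist N y' <= pi / 3 ->
  `|mdist x x' - mdist y y'| <= 2 * pi / 3.
Proof.
move=> Px Px' Ny Ny'; have xx' := P_diam Px Px'.
have := metric_triangle y N y'; rewrite (metric_sym y N).
have := mdist_ge0 x x'; have := mdist_ge0 y y'.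
by move=> *; rewrite ler_norml; apply/andP; split; lra.
Qed.

(** Replacing [x'] and [y'] by their antipodes moves both points into the same
cap and only changes the sign of the difference of the two distances. *)
Lemma opposite_cap_distortion x x' (N y y' : sphere R n.+1) :
  P x -> P (antipode x') ->
  mdist N y <= pi / 3 -> mdist (antipode N) y' <= pi / 3 ->
  `|mdist x x' - mdist y y'| <= 2 * pi / 3.
Proof.
move=> Px Px' Ny; rewrite mdist_antipodel -mdist_antipoder => Ny'.
have := cap_distortion Px Px' Ny Ny'; rewrite !mdist_antipoder distrC.
by congr (`|_| <= _); lra.
Qed.

Lemma sphere_corr_distortion x y x' y' :
  sphere_corr x y -> sphere_corr x' y' ->
  `|mdist x x' - mdist y y'| <= 2 * pi / 3.
Proof.
move=> xy xy'.
have dx := sphere_corr_displacement xy.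
have dx' := sphere_corr_displacement xy'.
have antipodeE (m : nat) (z z' : sphere R m) :
    mdist z z' = mdist (antipode z) (antipode z').
  by rewrite mdist_antipodel mdist_antipoder; lra.
case: xy => [band|Px _ Ny|Px _ Sy].
- by have := distortion_le_displacement band dx'; lra.
- case: xy' => [band'|Px' _ Ny'|Px' _ Sy'].
  + by have := distortion_le_displacement dx band'; lra.
  + exact: (cap_distortion Px Px' Ny Ny').
  + exact: (opposite_cap_distortion Px Px' Ny Sy').
- case: xy' => [band'|Px' _ Ny'|Px' _ Sy'].
  + by have := distortion_le_displacement dx band'; lra.
  + rewrite (metric_sym x) (metric_sym y).
    exact: (opposite_cap_distortion Px' Px Ny' Sy).
  + by rewrite (antipodeE _ x); exact: (cap_distortion Px Px' Sy Sy').
Qed.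

Lemma gromov_hausdorff_sphere_le :
  (gromov_hausdorff (sphere R n) (sphere R n.+1) <= (pi / 3)%:E)%E.
Proof.
apply: (gromov_hausdorff_le_correspondence _ sphere_corr_total
  sphere_corr_surjective).
  by have := pi_gt0 R; lra.
by move=> x y x' y' xy xy'; have := sphere_corr_distortion xy xy'; lra.
Qed.

End correspondence.

(** * The equilateral triangle and the bound *)

(** The three vertices [(1, 0)], [(- 1 / 2, s)] and [(- 1 / 2, - s)] of the first
coordinate plane have pairwise inner products [- 1 / 2], the cosine of
[2 * pi / 3], and sum to 0, so that a closed half-space always contains one of
them. *)
Lemma equilateral_triangle (R : realType) (n : nat) :
  exists P : set (sphere R n.+1),
    (forall p q, P p -> P q -> mdist p q <= 2 * pi / 3) /\
    (forall v : 'rV[R]_n.+2, exists2 p, P p & 0 <= dotv p v).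
Proof.
pose e0 : 'rV[R]_n.+2 := delta_mx ord0 ord0.
pose e1 : 'rV[R]_n.+2 := delta_mx ord0 (lift ord0 ord0).
pose w (a b : R) := a *: e0 + b *: e1.
have dot_w a b v : dotv (w a b) v = a * dotv e0 v + b * dotv e1 v.
  exact: dotv_linl.
have dot_ww a b c d : dotv (w a b) (w c d) = a * c + b * d.
  rewrite dot_w !(dotvC _ (w _ _)) !dotv_deltar !mxE /=; ring.
pose s : R := Num.sqrt 3 / 2.
have ss : s * s = 3 / 4.
  have : Num.sqrt 3 ^+ 2 = 3 :> R by rewrite sqr_sqrtr.
  by rewrite /s; lra.
pose vertex (a b : R) := (a, b) \in [:: (1, 0); (- 1 / 2, s); (- 1 / 2, - s)].
have vertexP a b : vertex a b ->
    [\/ a = 1 /\ b = 0, a = - 1 / 2 /\ b = s | a = - 1 / 2 /\ b = - s].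
  rewrite /vertex !inE !xpair_eqE => /or3P[] /andP[/eqP-> /eqP->];
  by [constructor 1 | constructor 2 | constructor 3].
exists [set p | exists a b, vertex a b /\ sphere_val p = w a b]; split.
  move=> p q [a [b [/vertexP ab pE]]] [c [d [/vertexP cd qE]]].
  have pi0 := pi_gt0 R; rewrite mdist_sphere_le; last by lra.
  have -> : cos (2 * pi / 3) = - 1 / 2 :> R.
    have -> : 2 * pi / 3 = - (pi / 3) + pi :> R by field.
    by rewrite cosDpi cosN cos_pi3; lra.
  rewrite pE qE dot_ww.
  by case: ab => -[-> ->]; case: cd => -[-> ->]; lra.
move=> v.
suff [a [b [ab abv]]] : exists a b, vertex a b /\ 0 <= dotv (w a b) v.
  have w1 : enorm (w a b) == 1.
    apply: enorm_eq1; rewrite dot_ww.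
    by case: (vertexP _ _ ab) => -[-> ->]; lra.
  by exists (Sphere w1) => //; exists a, b.
have [v0|v0] := leP 0 (dotv e0 v).
  exists 1, 0; split; first by rewrite /vertex !inE eqxx.
  by rewrite dot_w mul0r addr0 mul1r.
have s0 : 0 <= s by rewrite divr_ge0 // sqrtr_ge0.
have [v1|v1] := leP 0 (dotv e1 v).
  exists (- 1 / 2), s; split; first by rewrite /vertex !inE eqxx orbT.
  by rewrite dot_w; nra.
exists (- 1 / 2), (- s); split; first by rewrite /vertex !inE eqxx !orbT.
by rewrite dot_w; nra.
Qed.

Theorem theorem1p2 (R : realType) (n : nat) (hn : (1 <= n)%N) :
  (2%:E * gromov_hausdorff (sphere R n) (sphere R n.+1)
     <= (2 * pi / 3)%R%:E)%E.
Proof.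
case: n hn => // n _; have [P [P_diam P_halfspace]] := equilateral_triangle R n.
have -> : (2 * pi / 3)%:E = (2%:E * (pi / 3 : R)%:E)%E.
  by rewrite -EFinM mulrA.
by apply: lee_wpmul2l => //; exact: gromov_hausdorff_sphere_le P_diam P_halfspace.
Qed.
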